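(* Let $p\geq 2$ be a fixed integer. The average number of weak records of a composition in $\mathrm{MI}_n^p$ satisfies, as $n\to\infty$, $$\frac{1}{|\mathrm{MI}_n^p|}\sum_{x\in \mathrm{MI}_n^p}\mathtt{wrec}(x)\sim\frac{2n}{3p},$$ where $\mathtt{wrec}(x)$ denotes the number of weak records of $x$.
   Context: A composition of $n\ge 1$ is a tuple $(x_1,\ldots,x_m)$ of positive integers with $m\geq 1$ and $x_1+\cdots+x_m=n$. A weak record of $x=(x_1,\ldots,x_m)$ is a position $1\leq j\leq m$ such that $x_i\leq x_j$ for every $1\leq i\leq j$. $\mathbb{F}_n^p$ is the set of compositions of $n$ all of whose parts satisfy $1\leq x_i\leq p$. It is ordered by the dominance order: $(x_1,\ldots,x_m)\leq (y_1,\ldots,y_\ell)$ iff $\sum_{i=1}^k x_i\leq\sum_{i=1}^k y_i$ for all $1\leq k\leq\min(m,\ell)$. With this order $\mathbb{F}_n^p$ is a finite distributive lattice. An element $y$ is an upper cover of $x$ if $x<y$ and $x\le z\le y$ implies $z\in\{x,y\}$. $\mathrm{MI}_n^p$ is the set of meet-irreducible elements of $\mathbb{F}_n^p$, i.e. the elements having exactly one upper cover in $\mathbb{F}_n^p$. *)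

(* Defs.v *)
From HB Require Import structures.
From mathcomp Require Import all_boot all_order all_algebra.
From mathcomp Require Import finmap all_classical all_reals all_analysis.

Set Implicit Arguments.
Unset Strict Implicit.
Unset Printing Implicit Defensive.

Import Order.TTheory GRing.Theory Num.Theory.
Import numFieldNormedType.Exports.

Local Open Scope classical_set_scope.

Definition compositions (n p : nat) : set (seq nat) :=
  [set x | [/\ x != [::], sumn x = n & all (fun a => 1 <= a <= p) x]].

(* Only the partial sums up to the shorter length are compared. *)
Definition dom_le (x y : seq nat) : Prop :=
  forall k, 1 <= k <= minn (size x) (size y) ->
    sumn (take k x) <= sumn (take k y).

Definition dom_lt (x y : seq nat) : Prop := dom_le x y /\ x <> y.

Definition upper_cover (n p : nat) (x y : seq nat) : Prop :=
  [/\ compositions n p y, dom_lt x y &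
      forall z, compositions n p z -> dom_le x z -> dom_le z y ->
        z = x \/ z = y].

Definition MI (n p : nat) : set (seq nat) :=
  [set x | compositions n p x /\ exists! y, upper_cover n p x y].

(* Positions are 0-based. *)
Definition wrec (x : seq nat) : nat :=
  #|[pred j : 'I_(size x) |
      [forall i : 'I_(size x), (i <= j) ==> (nth 0 x i <= nth 0 x j)]]|.

(* fset_set and sums over a set have default values on infinite sets; the next
   two facts show that these are never used below. *)
Lemma finite_compositions (n p : nat) : finite_set (compositions n p).
Proof.
pose f (b : {bseq n of 'I_p.+1}) : seq nat := [seq nat_of_ord i | i <- b].
apply: (@sub_finite_set _ _ (f @` setT)); last first.
  exact/finite_image/finite_finset.
move=> x [_ sx /allP px].
have lx : size [seq inord i : 'I_p.+1 | i <- x] <= n.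
  rewrite size_map -sx; elim: x px {sx} => //= a x IH px.
  have /andP[a0 _] := px a (mem_head _ _).
  rewrite -add1n leq_add ?IH// => b bx.
  by apply: px; rewrite in_cons bx orbT.
exists (Bseq lx) => //=; rewrite /f /= -map_comp -[RHS]map_id.
by apply/eq_in_map => a /px /andP[_ ap] /=; rewrite inordK.
Qed.

Lemma finite_MI (n p : nat) : finite_set (MI n p).
Proof. by apply: sub_finite_set (finite_compositions n p) => x []. Qed.

Definition avg_wrec (R : realType) (p n : nat) : R :=
  ((\sum_(x \in MI n p) ((wrec x)%:R : R)) / #|` fset_set (MI n p)|%:R)%R.

(* Main.v *)
(** Moving one unit from a part to the preceding one raises a single partial sum
by 1, and these moves give exactly the upper covers. Hence an element is
meet-irreducible iff exactly one move is possible, which forces the shape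
[p^a b 1^c p^e l] with [1 <= b < p] and [1 <= l <= p]. Such a word has [a + e]
weak records up to an error of 1, except in the rare case [a = 0]. For fixed
[b, l], put [q = (n - b - l) / p]: the value [s = a + e] ranges over [0..q] and
is taken [s + 1] times, so its mean is [2 q / 3]; the average number of weak
records therefore stays at bounded distance from [2 n / (3 p)]. *)

Require Import Defs.
From mathcomp Require Import all_boot all_order all_algebra.
From mathcomp Require Import finmap all_classical all_reals all_analysis.
From mathcomp Require Import zify ring lra.
Import Order.TTheory GRing.Theory Num.Theory.
Import numFieldNormedType.Exports.
Local Open Scope classical_set_scope.

(** * Partial sums and the dominance order *)

(* Past the end of [x] this is the full sum [n], which turns the dominance order
   into the pointwise order on partial sums. *)
Definition psum (k : nat) (x : seq nat) : nat := sumn (take k x).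

Lemma psumS k x : psum k.+1 x = psum k x + nth 0 x k.
Proof.
rewrite /psum; have [kx|xk] := ltnP k (size x).
  by rewrite (take_nth 0 kx) sumn_rcons.
by rewrite !take_oversize ?(nth_default _ xk) ?addn0// leqW.
Qed.

Lemma leq_psum {k l} x : k <= l -> psum k x <= psum l x.
Proof.
move=> /subnK <-; elim: (l - k) => // j IH.
by rewrite addSn psumS (leq_trans IH) ?leq_addr.
Qed.

Lemma psum_size {k x} : size x <= k -> psum k x = sumn x.
Proof. by move=> xk; rewrite /psum take_oversize. Qed.

Lemma psum_le_sumn k x : psum k x <= sumn x.
Proof.
have [xk|/ltnW kx] := leqP (size x) k; first by rewrite psum_size.
by rewrite -(@psum_size (size x) x) ?leq_psum.
Qed.

(** Positivity matters: appending zeros to a word would not change its partial sums. *)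
Lemma psum_inj {x y} : all (leq 1) x -> all (leq 1) y ->
  (forall k, psum k x = psum k y) -> x = y.
Proof.
elim: x y => [|a x IH] [|b y] //=.
- by move=> _ /andP[b0 _] /(_ 1); rewrite /psum /= take0 /=; lia.
- by move=> /andP[a0 _] _ /(_ 1); rewrite /psum /= take0 /=; lia.
move=> /andP[_ x0] /andP[_ y0] e.
have ab : a = b by have := e 1; rewrite /psum /= !take0 /= !addn0.
rewrite ab (IH y)// => k; have := e k.+1.
by rewrite /psum /= ab => /addnI.
Qed.

Lemma compositions_gt0 {n p x} : compositions n p x -> all (leq 1) x.
Proof. by case=> _ _; apply: sub_all => a /andP[]. Qed.

Lemma compositions_sumn {n p x} : compositions n p x -> sumn x = n.
Proof. by case. Qed.

Lemma compositions_nth {n p x} i : compositions n p x -> i < size x ->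
  1 <= nth 0 x i <= p.
Proof. by move=> [_ _ /all_nthP h] /h. Qed.

(** Past the end of [y] its sum is already [n]; past the end of [x], the comparison at [size x] has
    forced the sum of [y] up to [n]. *)
Lemma dom_leP {n p x y} : compositions n p x -> compositions n p y ->
  dom_le x y <-> forall k, psum k x <= psum k y.
Proof.
move=> cx cy; split=> [h k|h k _]; last exact: h.
have [->|k0] := posnP k; first by rewrite /psum !take0.
have [ky|yk] := leqP k (size y); last first.
  rewrite (psum_size (ltnW yk)) (compositions_sumn cy) -(compositions_sumn cx).
  exact: psum_le_sumn.
have [kx|xk] := leqP k (size x); first by apply: h; rewrite leq_min k0 kx.
have x0 : 0 < size x by case: cx; case: (x).
rewrite (psum_size (ltnW xk)) -(psum_size (leqnn _)).
apply: leq_trans (leq_psum _ (ltnW xk)).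
by apply: h; rewrite leq_min x0 leqnn (leq_trans (ltnW xk) ky).
Qed.

(** * Raising moves and upper covers *)

(* The positions (0-based) at which one unit can be moved from the next part to
   the current one; a last part equal to 1 then disappears. *)
Definition raisable (p : nat) (x : seq nat) (i : nat) : bool :=
  [&& i.+1 < size x, nth 0 x i < p &
      (i.+2 == size x) || (1 < nth 0 x i.+1)].

Definition raises (i : nat) (x y : seq nat) : Prop :=
  forall k, psum k y = psum k x + (k == i.+1).

Lemma raises_exists_all {p x i} : all (fun a => 1 <= a <= p) x ->
  raisable p x i ->
  exists z : seq nat,
    [/\ z != [::], all (fun a => 1 <= a <= p) z & raises i x z].
Proof.
elim: i x => [|i IH] [|a x] //=; last first.
  move=> /andP[ha hx] /(IH _ hx)[z [z0 hz rz]].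
  exists (a :: z); split=> //=; first by rewrite ha.
  by case=> [|k]; rewrite /psum //= ?take0// eqSS -addnA -rz.
case: x => [|d v] //= /andP[/andP[a0 ap] /andP[/andP[d0 dp] hv]].
rewrite /raisable /= => /andP[{}ap].
have [->|d1] := eqVneq d 1.
  rewrite orbF !eqSS eq_sym => /nilP ->.
  exists [:: a.+1]; split; rewrite //= ?ap//.
  by case=> [|[|k]]; rewrite /psum /= ?addn0 ?addn1.
move=> _; exists (a.+1 :: d.-1 :: v); split=> //=.
  by rewrite hv ap andbT /=; lia.
by case=> [|[|k]]; rewrite /psum /= ?take0//=; lia.
Qed.

Lemma raises_exists {n p x i} : compositions n p x -> raisable p x i ->
  exists2 z, compositions n p z & raises i x z.
Proof.
move=> [_ sx hx] rx; have [z [z0 hz rz]] := raises_exists_all hx rx.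
exists z => //; split=> //.
(* Beyond both lengths and beyond [i.+1], [raises] becomes equality of the full sums. *)
pose k := size z + size x + i.+2.
have := rz k; rewrite !psum_size ?sx /k; lia.
Qed.

(* Take the last position where [x] is below [y] and the part of [x] is less
   than [p]: a next part equal to 1 would give a later such position. *)
Lemma raisable_exists {n p x y} : 1 < p ->
  compositions n p x -> compositions n p y -> dom_lt x y ->
  exists2 i, raisable p x i & psum i.+1 x < psum i.+1 y.
Proof.
move=> p1 cx cy [/(dom_leP cx cy) xy neq].
pose D := fun i => (psum i.+1 x < psum i.+1 y) && (nth 0 x i < p).
have exD : exists i, D i.
  have ex : exists k, psum k x < psum k y.
    apply: contrapT => /forallNP h; apply: neq.
    apply: psum_inj (compositions_gt0 cx) (compositions_gt0 cy) _ => k.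
    by apply/eqP; rewrite eqn_leq xy leqNgt; apply/negP/h.
  (* Where [x] first falls below [y], its part is smaller than that of [y], hence less than [p]. *)
  case: (ex_minnP ex) => -[|k] lt min; first by move: lt; rewrite /psum !take0.
  have le : psum k y <= psum k x.
    by rewrite leqNgt; apply/negP => /min; rewrite ltnn.
  exists k; rewrite /D lt /=; move: lt; rewrite !psumS.
  have : nth 0 y k <= p.
    have [ky|yk] := ltnP k (size y); last by rewrite nth_default.
    by have /andP[] := compositions_nth k cy ky.
  lia.
have ltsz i : psum i x < psum i y -> i < size x.
  move=> lt; rewrite ltnNge; apply/negP => xi; move: lt.
  rewrite (psum_size xi) (compositions_sumn cx) -(compositions_sumn cy).
  by rewrite ltnNge psum_le_sumn.
have bd i : D i -> i <= size x by move=> /andP[/ltsz/ltnW/ltnW].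
case: (ex_maxnP exD bd) => i Di max; have /andP[lt ip] := Di.
exists i => //; rewrite /raisable (ltsz _ lt) ip /=.
apply/norP => -[nsz]; rewrite -leqNgt => le1.
have isz := ltsz _ lt.
have x1 : nth 0 x i.+1 = 1 by have := compositions_nth i.+1 cx isz; lia.
suff /max : D i.+1 by rewrite ltnn.
rewrite /D x1 p1 andbT psumS x1.
(* If [y] goes on, its next part is at least 1 and the gap persists; if it has ended, its sum is
   [n], which [x] has not reached since a part at [i.+2] remains. *)
have [yi|iy] := leqP (size y) i.+1; last first.
  by rewrite (psumS i.+1 y); have := compositions_nth i.+1 cy iy; lia.
rewrite (psum_size (leqW yi)) (compositions_sumn cy) -(compositions_sumn cx).
have isz2 : i.+2 < size x by rewrite ltn_neqAle nsz.
rewrite -x1 -psumS; apply: leq_trans (psum_le_sumn i.+3 x).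
by rewrite (psumS i.+2); have := compositions_nth i.+2 cx isz2; lia.
Qed.

Lemma raises_dom_lt {n p x y i} : compositions n p x -> compositions n p y ->
  raises i x y -> dom_lt x y.
Proof.
move=> cx cy r; split; first by apply/(dom_leP cx cy) => k; rewrite r leq_addr.
by move=> xy; have := r i.+1; rewrite xy eqxx; lia.
Qed.

(** Any [y] strictly above [x] lies above some raise of [x], so a cover is a raise; and a raise adds
    1 to a single partial sum, which leaves no room in between. *)
Lemma upper_coverP {n p x y} : 1 < p -> compositions n p x ->
  upper_cover n p x y <->
  compositions n p y /\ exists2 i, raisable p x i & raises i x y.
Proof.
move=> p1 cx; split=> [[cy xy h]|[cy [i ri r]]].
  split=> //; have [i ri lt] := raisable_exists p1 cx cy xy.
  have [z cz rz] := raises_exists cx ri; exists i => //.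
  have xz := raises_dom_lt cx cz rz.
  have zy : dom_le z y.
    apply/(dom_leP cz cy) => k; rewrite rz.
    have [->|_] := eqVneq k i.+1; first by rewrite addn1.
    by rewrite addn0; apply: (dom_leP cx cy).1; case: xy.
  case: (h z cz xz.1 zy) => [zx|<-//].
  by case: xz => _ /(_ (esym zx)).
split=> //; first exact: raises_dom_lt cx cy r.
move=> z cz /(dom_leP cx cz) xz /(dom_leP cz cy) zy.
have zk k : k != i.+1 -> psum k z = psum k x.
  by move=> /negPf ki; have := xz k; have := zy k; rewrite r ki; lia.
have := xz i.+1; have := zy i.+1; rewrite r eqxx => z1 z2.
have [e|ne] := eqVneq (psum i.+1 z) (psum i.+1 x); [left|right].
  apply: psum_inj (compositions_gt0 cz) (compositions_gt0 cx) _ => k.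
  by have [->//|/zk] := eqVneq k i.+1.
apply: psum_inj (compositions_gt0 cz) (compositions_gt0 cy) _ => k.
by rewrite r; have [->|/zk->] := eqVneq k i.+1; lia.
Qed.

(** Raisable positions and covers are in bijection: the position is read off from the partial sum
    that grew. *)
Lemma MI_raisable {n p x} : 1 < p ->
  MI n p x <-> compositions n p x /\ exists! i, raisable p x i.
Proof.
move=> p1; split=> -[cx H]; split=> //.
  case: H => y [/(upper_coverP p1 cx)[cy [i ri r]] uniq].
  exists i; split=> // j rj; have [z cz rz] := raises_exists cx rj.
  have yz : y = z.
    by apply: uniq; apply/(upper_coverP p1 cx); split=> //; exists j.
  have := rz i.+1; rewrite -yz r eqxx eqSS => /addnI.
  by case: eqP.
case: H => i [ri uniq]; have [y cy ry] := raises_exists cx ri.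
exists y; split=> [|z /(upper_coverP p1 cx)[cz [j rj rz]]].
  by apply/(upper_coverP p1 cx); split=> //; exists i.
apply: psum_inj (compositions_gt0 cy) (compositions_gt0 cz) _ => k.
by rewrite ry rz (uniq j).
Qed.

(** * Shape of the meet-irreducible elements *)

(* The default value 2 of [head] stands for the last part, which follows [y]
   and can always give up a unit. *)
Fixpoint nraises (p : nat) (y : seq nat) : nat :=
  if y is b :: t then (b < p) && (1 < head 2 t) + nraises p t else 0.

Lemma nraisesE p y : nraises p y =
  count (fun i => (nth 0 y i < p) && (1 < nth 2 y i.+1)) (iota 0 (size y)).
Proof.
elim: y => //= b t ->; rewrite -(addn0 1) iotaDl count_map nth0.
by congr (_ + _); apply: eq_count => i /=; rewrite add1n.
Qed.

Lemma raisable_rcons p y l i : raisable p (rcons y l) i =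
  (i < size y) && ((nth 0 y i < p) && (1 < nth 2 y i.+1)).
Proof.
rewrite /raisable size_rcons ltnS; case: ltnP => //= iy.
rewrite !nth_rcons iy eqSS; congr (_ && _).
have [lt|] := ltnP i.+1 (size y); last first.
  by move=> ge; rewrite (nth_default 2 ge) eqn_leq iy ge.
by rewrite ltn_eqF //= (set_nth_default 2).
Qed.

Lemma exists1_raisable p y l :
  (exists! i, raisable p (rcons y l) i) <-> nraises p y = 1.
Proof.
pose s := [seq i <- iota 0 (size y) |
            (nth 0 y i < p) && (1 < nth 2 y i.+1)].
have us : uniq s by rewrite filter_uniq ?iota_uniq.
have ms i : raisable p (rcons y l) i = (i \in s).
  by rewrite mem_filter mem_iota raisable_rcons andbC.
rewrite nraisesE -size_filter -/s; split=> [[i [ri iu]]|].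
  suff -> : s = [:: i] by [].
  apply: perm_small_eq => //; apply: uniq_perm => // j.
  rewrite inE -ms; apply/idP/eqP => [/iu|->]//.
case: s us ms => [|i [|]] // _ ms _; exists i.
by split=> [|j]; rewrite ms ?mem_head// inE => /eqP.
Qed.

(** All parts but the last of a meet-irreducible element; the free last part is appended by
    [rcons]. *)
Definition stem (p a b c e : nat) : seq nat :=
  nseq a p ++ b :: nseq c 1 ++ nseq e p.

(** From the right, each part is followed by a value above 1 (the default 2, then [p]), so a part
    below [p] could be raised. *)
Lemma nraises_eq0 {p y} : 1 < p -> all (fun a => 1 <= a <= p) y ->
  nraises p y = 0 -> y = nseq (size y) p.
Proof.
move=> p1; elim: y => //= b t IH /andP[/andP[b0 bp] ht] /eqP.
rewrite addn_eq0 => /andP[h /eqP/(IH ht) et].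
have : 1 < head 2 t by rewrite et; case: (size t).
move: h; rewrite eqb0 => h th; rewrite th andbT -leqNgt in h.
by congr (_ :: _) => //; apply/eqP; rewrite eqn_leq bp.
Qed.

(** If the first part can be raised, the rest is all [p]. Otherwise it is [p] and extends [p^a], or
    it is followed by 1, so that the tail has [a = 0] and its [b'] joins the block of ones. *)
Lemma nraises_eq1 {p y} : 1 < p -> all (fun a => 1 <= a <= p) y ->
  nraises p y = 1 -> exists a b c e, 1 <= b < p /\ y = stem p a b c e.
Proof.
move=> p1; elim: y => //= b t IH /andP[/andP[b0 bp] ht].
case: andP => [[lbp _]|nr].
  rewrite add1n => -[/(nraises_eq0 p1 ht) ->].
  by exists 0, b, 0, (size t); rewrite b0 lbp.
move=> /(IH ht)[a [b' [c [e [hb' et]]]]].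
have [bep|bnp] := eqVneq b p.
  by exists a.+1, b', c, e; rewrite et bep.
have lbp : b < p by rewrite ltn_neqAle bnp.
have : ~~ (1 < head 2 t) by apply/negP => th; apply: nr.
rewrite et; case: a et => [|a] /= et; last by rewrite p1.
rewrite -leqNgt => lb'; have b'1 : b' = 1 by move: hb' lb'; lia.
by exists 0, b, c.+1, e; rewrite b0 lbp b'1.
Qed.

Lemma nraises_nseq p e : nraises p (nseq e p) = 0.
Proof. by elim: e => //= e ->; rewrite ltnn. Qed.

Lemma nraises_stem {p a b c e} : 1 < p -> b < p ->
  nraises p (stem p a b c e) = 1.
Proof.
move=> p1; rewrite /stem; elim: a => [|a IH] //= bp; last by rewrite ltnn IH.
elim: c b bp => [|c IH] b bp /=; last by rewrite bp IH.
by rewrite bp nraises_nseq; case: e => //= e; rewrite p1.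
Qed.

Lemma MI_stem {n p x} : 1 < p -> MI n p x <->
  exists a b c e l, [/\ 1 <= b < p, 1 <= l <= p,
    x = rcons (stem p a b c e) l & p * (a + e) + b + c + l = n].
Proof.
move=> p1; have sumE a b c e l : sumn (rcons (stem p a b c e) l) =
    p * (a + e) + b + c + l.
  by rewrite sumn_rcons /stem sumn_cat /= sumn_cat !sumn_nseq; lia.
rewrite (MI_raisable p1); split=> [[[]]|].
  case/lastP: x => // y l _; rewrite all_rcons => sy /andP[hl hy].
  rewrite exists1_raisable => /(nraises_eq1 p1 hy)[a [b [c [e [hb ey]]]]].
  by exists a, b, c, e, l; split=> //; rewrite -?sumE -?ey.
move=> [a [b [c [e [l [/andP[b0 bp] hl -> sn]]]]]].
split; last by rewrite exists1_raisable nraises_stem.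
split; [by case: (stem _ _ _ _ _)|by rewrite sumE|].
rewrite all_rcons hl /stem all_cat /= all_cat !all_nseq b0 (ltnW bp).
by rewrite leqnn (ltnW p1) !orbT.
Qed.

(** [a] is the position of the first letter below [p], and [e] counts the letters [p] after it. *)
Lemma stem_inj {p a b c e a' b' c' e'} : 1 < p -> b < p -> b' < p ->
  stem p a b c e = stem p a' b' c' e' -> [/\ a = a', b = b' & e = e'].
Proof.
move=> p1 bp bp' E.
have fnd k d r : d < p -> find (fun z => z < p) (nseq k p ++ d :: r) = k.
  by elim: k => /= [->|k IH /IH ->]//; rewrite ltnn.
have aa : a = a'.
  by have := congr1 (find (fun z => z < p)) E; rewrite !fnd.
move: E; rewrite /stem aa => /eqP; rewrite eqseq_cat // => /andP[_ /eqP[bb E]].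
split=> //; have := congr1 (count_mem p) E; rewrite !count_cat !count_nseq /=.
by rewrite eqxx !(ltn_eqF p1); lia.
Qed.

(** * Weak records of these words *)

Lemma count_ord (Q : pred nat) (x : seq nat) :
  #|[pred j : 'I_(size x) | Q (nth 0 x j)]| = count Q x.
Proof.
by rewrite -sum1_card -sum1_count (big_nth 0) big_mkord.
Qed.

Lemma count_le_wrec {p x} : all (fun a => a <= p) x -> count_mem p x <= wrec x.
Proof.
move=> /(all_nthP 0) hx; rewrite -count_ord.
apply/subset_leq_card/fintype.subsetP => j.
rewrite !inE => /eqP ->; apply/forallP => i; apply/implyP => _.
exact: hx.
Qed.

Lemma wrec_cons_le a x : wrec (a :: x) <= count (leq a) (a :: x).
Proof.
rewrite -count_ord; apply/subset_leq_card/fintype.subsetP => j.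
by rewrite !inE => /forallP/(_ ord0).
Qed.

Lemma wrec_le_size x : wrec x <= size x.
Proof. by rewrite -[leqRHS]card_ord max_card. Qed.

Lemma wrec_stem_ge {p a b c e l} : b < p -> l <= p -> 1 < p ->
  a + e <= wrec (rcons (stem p a b c e) l).
Proof.
move=> bp lp p1.
have /count_le_wrec/(leq_trans _) : all (leq^~ p) (rcons (stem p a b c e) l).
  rewrite all_rcons lp /stem all_cat /= all_cat !all_nseq (ltnW bp) leqnn.
  by rewrite (ltnW p1) !orbT.
apply; rewrite -cats1 /stem !count_cat /= count_cat !count_nseq /= ?eqxx.
by lia.
Qed.

(** The word starts with [p], so only letters [p] or larger are weak records; the extra 1 allows for
    the last part. *)
Lemma wrec_stem_le {p a b c e l} : 0 < a -> b < p -> 1 < p ->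
  wrec (rcons (stem p a b c e) l) <= (a + e).+1.
Proof.
case: a => // a _ bp p1.
apply: leq_trans (wrec_cons_le p (rcons (stem p a b c e) l)) _.
rewrite -cats1 /= /stem !count_cat /= count_cat !count_nseq.
rewrite leqnn (leqNgt p 1) p1 (leqNgt p b) bp /=; lia.
Qed.

(** The length is a sufficient bound, since [a = 0] occurs only once for each [s]. *)
Lemma wrec_stem0_le p b c e l : wrec (rcons (stem p 0 b c e) l) <= (c + e).+2.
Proof.
apply: leq_trans (wrec_le_size _) _.
by rewrite size_rcons /stem /= size_cat !size_nseq.
Qed.

(** * Parametrization and sums over it *)

(* [((b, l), (s, a))] encodes the word [p^a (b+1) 1^c p^(s-a) (l+1)], where [c]
   is determined by the sum [n]. *)
Definition code (p n : nat) : finType :=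
  (('I_p.-1 * 'I_p) * ('I_n.+1 * 'I_n.+1))%type.

(** The part of [n] left for the letters [p] and the ones; the 2 is due to storing [b] and [l]
    decreased by 1. When [p.*2 <= n] the subtraction does not truncate. *)
Definition slack (n b l : nat) : nat := n - (b + l).+2.

Definition valid_code {p n : nat} (t : code p n) : bool :=
  (p * t.2.1 <= slack n t.1.1 t.1.2) && (t.2.2 <= t.2.1).

Definition MI_word {p n : nat} (t : code p n) : seq nat :=
  rcons (stem p t.2.2 t.1.1.+1 (slack n t.1.1 t.1.2 - p * t.2.1)
              (t.2.1 - t.2.2)) t.1.2.+1.

Lemma MI_word_inj p n : 1 < p ->
  {in @valid_code p n &, injective (@MI_word p n)}.
Proof.
move=> p1 [[b l] [s a]] [[b' l'] [s' a']]; rewrite !unfold_in /valid_code /=.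
move=> /andP[_ sa] /andP[_ sa'].
have bp (d : 'I_p.-1) : d.+1 < p by have := ltn_ord d; lia.
move=> /rcons_inj[/(stem_inj p1 (bp _) (bp _))[aa [bb] ee] ll].
have ss : s = s' :> nat by lia.
by congr (_, _, (_, _)); apply/val_inj.
Qed.

Lemma MI_wordE p n : 1 < p -> p.*2 <= n ->
  MI n p = [set` [seq MI_word t | t <- enum (@valid_code p n)]].
Proof.
move=> p1 pn; apply/seteqP; split=> x.
  move=> /(MI_stem p1)[a [b [c [e [l [hb hl -> sn]]]]]] /=.
  have bp : b.-1 < p.-1 by lia.
  have lp : l.-1 < p by lia.
  have sn' : a + e < n.+1 by nia.
  have an : a < n.+1 by lia.
  apply/mapP; exists ((Ordinal bp, Ordinal lp), (Ordinal sn', Ordinal an)).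
    by rewrite mem_enum unfold_in /valid_code /= /slack; lia.
  rewrite /MI_word /= /slack !prednK; try lia.
  by congr (rcons (stem _ _ _ _ _) _); lia.
move=> /mapP[[[b l] [s a]]]; rewrite mem_enum unfold_in /valid_code /=.
move=> /andP[sn sa] ->; apply/(MI_stem p1).
have := ltn_ord b; have := ltn_ord l => lp bp.
do 5!eexists; split; [| |reflexivity|]; rewrite /= ?subnKC //; try lia.
by move: sn; rewrite /slack; lia.
Qed.

Lemma sum_MI (R : realType) p n (F : seq nat -> nat) : 1 < p -> p.*2 <= n ->
  (\sum_(x \in MI n p) ((F x)%:R : R) =
   (\sum_(t | @valid_code p n t) F (MI_word t))%N%:R)%R.
Proof.
move=> p1 pn; rewrite (MI_wordE _ _ p1 pn) -fsbig_seq; last first.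
  rewrite map_inj_in_uniq ?enum_uniq// => t u.
  by rewrite !mem_enum; apply: MI_word_inj.
by rewrite big_map big_enum natr_sum.
Qed.

(** Lets [sum_MI] treat the denominator of the average like its numerator. *)
Lemma card_fset_set_sum (R : realType) (T : choiceType) (A : set T) :
  finite_set A ->
  (#|` fset_set A|%:R = \sum_(x \in A) (1%:R : R))%R.
Proof. by move=> fA; rewrite fsbig_finite// -natr_sum sum1_size. Qed.

Lemma sum_triangle q : 2 * \sum_(s < q.+1) s.+1 = q.+1 * q.+2.
Proof.
by elim: q => [|q IH]; rewrite big_ord_recr ?big_ord0 //= mulnDr ?IH; lia.
Qed.

(** The source of the factor 2/3: [s] with weight [s + 1] has mean [2q / 3]. *)
Lemma sum_triangle_mul q :
  3 * \sum_(s < q.+1) s.+1 * s = 2 * q * \sum_(s < q.+1) s.+1.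
Proof.
have -> : 2 * q * \sum_(s < q.+1) s.+1 = q * (q.+1 * q.+2).
  by rewrite -sum_triangle; lia.
by elim: q => [|q IH]; rewrite big_ord_recr ?big_ord0 //= mulnDr ?IH; lia.
Qed.

(** The constraint on [s] reads [s <= slack %/ p], which is at most [n], so the index type ['I_n.+1]
    cuts nothing off. *)
Lemma sum_codes p n (F : nat -> nat -> nat -> nat -> nat) : 1 < p ->
  \sum_(t | @valid_code p n t) F t.1.1 t.1.2 t.2.1 t.2.2 =
  \sum_(b < p.-1) \sum_(l < p) \sum_(s < (slack n b l %/ p).+1)
    \sum_(a < s.+1) F b l s a.
Proof.
move=> p1; rewrite pair_bigA /=.
have narrow m (G : nat -> nat) : m <= n ->
    \sum_(s < n.+1 | s <= m) G s = \sum_(s < m.+1) G s.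
  by move=> mn; rewrite (big_ord_narrow_leq mn).
transitivity (\sum_(u : 'I_p.-1 * 'I_p)
    \sum_(v : 'I_n.+1 * 'I_n.+1 |
      (v.1 <= slack n u.1 u.2 %/ p) && (v.2 <= v.1)) F u.1 u.2 v.1 v.2).
  rewrite pair_big_dep /=; apply: eq_bigl => t.
  by rewrite /valid_code leq_divRL ?(ltnW p1)// mulnC.
apply: eq_bigr => u _.
rewrite -(pair_big_dep (fun s : 'I_n.+1 => s <= slack n u.1 u.2 %/ p)
  (fun s a : 'I_n.+1 => a <= s) (fun s a : 'I_n.+1 => F u.1 u.2 s a)) /=.
rewrite -(narrow _ (fun s => \sum_(a < s.+1) F u.1 u.2 s a)); last first.
  by rewrite (leq_trans (leq_div _ _))// leq_subr.
apply: eq_bigr => s _; apply: (narrow s (F u.1 u.2 s)).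
by rewrite -ltnS ltn_ord.
Qed.

(** * Bounds for fixed [b] and [l] *)

Section Block.
Variables (p n b l : nat).
Hypotheses (p1 : 1 < p) (pn : p.*2 <= n) (bp : b < p.-1) (lp : l < p).

Let q := slack n b l %/ p.
Let w s a := wrec (rcons (stem p a b.+1 (slack n b l - p * s) (s - a)) l.+1).
Let T := \sum_(s < q.+1) \sum_(a < s.+1) w s a.
Let C := \sum_(s < q.+1) \sum_(a < s.+1) 1.

Let CE : C = \sum_(s < q.+1) s.+1.
Proof. by apply: eq_bigr => s _; rewrite sum_nat_const card_ord muln1. Qed.

Let pq_le : p * q <= n.
Proof.
by rewrite mulnC (leq_trans (leq_divM _ _))// leq_subr.
Qed.

Let lt_pq : n < p * (q + 3).
Proof.
(* Rounding loses less than [p] and [b + l + 2] is below [2p], whence the 3. *)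
have : slack n b l < q.+1 * p by rewrite ltn_ceil// ltnW.
by rewrite /slack; lia.
Qed.

Let b1p : b.+1 < p. Proof. lia. Qed.

Lemma block_ge : 2 * n * C <= 3 * p * T + 6 * p * C.
Proof.
have : 2 * q * C <= 3 * T.
  rewrite CE -sum_triangle_mul leq_mul2l /=; apply: leq_sum => s _.
  rewrite -{1}(card_ord s.+1) -sum_nat_const; apply: leq_sum => a _.
  by rewrite -{1}(subnKC (ltn_ord a : a <= s)); apply: wrec_stem_ge.
by move: lt_pq; clear; nia.
Qed.

(** The term [3 * p] collects the excess 1 per word, and [12 * p ^ 2] the words with [a = 0]. *)
Lemma block_le : 3 * p * T <= (2 * n + 3 * p + 12 * p ^ 2) * C.
Proof.
have bd : T <= \sum_(s < q.+1) (s.+1 * s.+1 + n.+1).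
  apply: leq_sum => s _; rewrite big_ord_recl addnC.
  have sn : s <= n by have := ltn_ord s; move: pq_le p1; clear; nia.
  apply: (@leq_trans (s * s.+1 + (s + n.+1))); last lia.
  have -> : s * s.+1 = \sum_(a < s) s.+1 by rewrite sum_nat_const card_ord.
  apply: leq_add.
    apply: leq_sum => a _; apply: leq_trans (wrec_stem_le _ b1p p1) _ => //.
    by rewrite subnKC ?lift0 ?ltn_ord.
  apply: leq_trans (wrec_stem0_le _ _ _ _ _) _.
  by rewrite /slack subn0; lia.
have e1 : \sum_(s < q.+1) (s.+1 * s.+1 + n.+1) =
    \sum_(s < q.+1) s.+1 * s + C + q.+1 * n.+1.
  rewrite big_split /= sum_nat_const card_ord CE -big_split /=; congr (_ + _).
  by apply: eq_bigr => s _; rewrite mulnS addnC.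
have e2 := sum_triangle_mul q; have e3 := sum_triangle q.
rewrite -CE in e2 e3.
(* [n.+1] is at most [2 * p * q.+2], while [2 * C] is [q.+1 * q.+2]. *)
have e4 : q.+1 * n.+1 <= 4 * p * C.
  have -> : 4 * p * C = q.+1 * (2 * p * q.+2)
    by transitivity (2 * p * (2 * C)); [lia|rewrite e3; lia].
  by rewrite leq_mul2l; move: lt_pq; clear; nia.
have e5 : 3 * T <= (2 * q + 3 + 12 * p) * C by lia.
have : p * (3 * T) <= p * ((2 * q + 3 + 12 * p) * C).
  by rewrite leq_mul2l e5 orbT.
by move: pq_le; clear; nia.
Qed.

End Block.

Lemma total_bounds p n : 1 < p -> p.*2 <= n ->
  let T := \sum_(t | @valid_code p n t) wrec (MI_word t) in
  let C := \sum_(t | @valid_code p n t) 1 in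
  [/\ 2 * n * C <= 3 * p * T + 6 * p * C,
      3 * p * T <= (2 * n + 3 * p + 12 * p ^ 2) * C & 0 < C].
Proof.
move=> p1 pn /=.
have -> := @sum_codes p n (fun b l s a =>
  wrec (rcons (stem p a b.+1 (slack n b l - p * s) (s - a)) l.+1)) p1.
have -> := @sum_codes p n (fun _ _ _ _ => 1) p1.
split; last first.
- case: p p1 {pn} => [|[|p]] // _.
  by do 4!(rewrite big_ord_recl; apply: ltn_addr).
- rewrite !big_distrr /=; apply: leq_sum => b _.
  rewrite !big_distrr /=; apply: leq_sum => l _.
  exact: block_le.
rewrite !big_distrr /= -big_split; apply: leq_sum => b _ /=.
rewrite !big_distrr /= -big_split; apply: leq_sum => l _ /=.
exact: block_ge.
Qed.

(** * The asymptotic estimate *)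

Local Open Scope ring_scope.

(** After division by [3 * p * C], the lower bound has error 2 and the upper one [4 * p + 1]; the
    constant covers both. *)
Lemma avg_wrec_bound (R : realType) (p n : nat) : (1 < p)%N -> (p.*2 <= n)%N ->
  `|avg_wrec R p n - (2 * n%:R) / (3 * p%:R)| <= 4 * p%:R + 2.
Proof.
move=> p1 pn; rewrite /avg_wrec (card_fset_set_sum _ _ _ (finite_MI n p)).
rewrite (sum_MI _ _ _ _ p1 pn) (sum_MI _ _ _ (fun=> 1%N) p1 pn).
have [] := total_bounds _ _ p1 pn.
set T := (\sum_(t | _) wrec _)%N; set C := (\sum_(t | _) _)%N.
rewrite -!(ler_nat R) !(natrD, natrM, natrX) => lo up /(lt_le_trans ltr01) C0.
have p0 : (0 : R) < p%:R by rewrite ltr0n ltnW.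
move: lo up C0 p0; move: (T%:R : R) (C%:R : R) (n%:R : R) (p%:R : R).
move=> {}T {}C x y lo up C0 y0.
have -> : T / C - 2 * x / (3 * y) = (3 * y * T - 2 * x * C) / (3 * y * C).
  by field; rewrite !gt_eqF.
rewrite ler_norml lerNl -mulNr !ler_pdivrMr ?mulr_gt0//.
have := mulr_gt0 y0 C0; have := mulr_ge0 (mulr_ge0 (ltW y0) (ltW y0)) (ltW C0).
by move=> ? ?; apply/andP; split; nra.
Qed.

Theorem proposition3p6 (R : realType) (p : nat) (hp : (2 <= p)%N) :
  (fun n : nat => avg_wrec R p n)
    ~_\oo (fun n : nat => (2 * n%:R) / (3 * p%:R) : R).
Proof.
apply/eqaddoP => e e0.
have p0 : (0 : R) < p%:R by rewrite ltr0n ltnW.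
near=> n.
have pn : (p.*2 <= n)%N by near: n; exact: nbhs_infty_ge.
(* The error bound is constant in [n], so solving for [n] gives the threshold beyond which it is at
   most [e] times [2n / (3p)]. *)
apply: le_trans (avg_wrec_bound R p n hp pn) _.
rewrite ger0_norm ?divr_ge0 ?mulr_ge0 ?ler0n// mulrA.
rewrite ler_pdivlMr ?mulr_gt0// mulrCA -ler_pdivrMl//.
rewrite -ler_pdivrMl//.
by near: n; exact: nbhs_infty_ger.
Unshelve. all: by end_near.
Qed.
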